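(* Let $X$ be a continuum and $n\in\mathbb N$. Then each of the following subsets of $2^X$ is of type $G_\delta$ in $2^X$: (i) $CC_n(X)$; (ii) $NBO_n(X)$; (iii) $S_n(X)$; (iv) $NSC_n(X)$.
   Context: All spaces are metric; a continuum is a compact connected space with more than one point; $\mathbb N=\{1,2,\dots\}$. For a non-empty space $Y$ and $n\in\mathbb N$: $2^Y$ is the set of non-empty compact subsets of $Y$, endowed with the Hausdorff metric; $F_n(Y)$ is the set of elements of $2^Y$ with at most $n$ points; $C_n(Y)$ is the set of elements of $2^Y$ with at most $n$ components. A non-empty space $Y$ is (interiors taken in $Y$): - $n$-$Q1$ if there exists $B\in F_n(Y)$ such that for each $x\in Y$ there exists a continuum $D\subset Y$ with $x\in \mathrm{int}(D)$ and $B\cap D\neq\emptyset$; - $n$-$Qo$ if there exists $B\in F_n(Y)$ such that for every non-empty open set $U$ of $Y$ there exists a continuum $D\subset Y$ with $B\cap \mathrm{int}(D)\neq\emptyset\neq \mathrm{int}(D)\cap U$; - $n$-$Q5$ if for each finite family $\mathcal U$ of non-empty open subsets of $Y$ there exists $D\in C_n(Y)$ with $D\cap U\neq\emptyset$ for every $U\in\mathcal U$; - $n$-$Q6$ if for each collection of $n+1$ non-empty open sets $U_1,\dots,U_{n+1}$ of $Y$ there exists $D\in C_n(Y)$ with $D\cap U_i\neq\emptyset$ for every $i\in\{1,\dots,n+1\}$. For a non-degenerate compact metric space $X$: $CC_n(X)=\{A\in 2^X: A=X$ or $X-A$ is $n$-$Q1\}$; $NBO_n(X)=\{A\in 2^X: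 A=X$ or $X-A$ is $n$-$Qo\}$; $S_n(X)=\{A\in 2^X: A=X$ or $X-A$ is $n$-$Q5\}$; $NSC_n(X)=\{A\in 2^X: A=X$ or $X-A$ is $n$-$Q6\}$. *)

(* Defs.v *)
From HB Require Import structures.
From mathcomp Require Import all_boot all_order all_algebra.
From mathcomp Require Import all_classical all_reals all_analysis.
From mathcomp Require Import borel_hierarchy.

Set Implicit Arguments.
Unset Strict Implicit.
Unset Printing Implicit Defensive.

Import Order.TTheory GRing.Theory Num.Theory.
Local Open Scope classical_set_scope.
Local Open Scope card_scope.
Local Open Scope ring_scope.

Definition is_continuum (T : topologicalType) (D : set T) : Prop :=
  [/\ compact D, connected D & exists x y, [/\ D x, D y & x <> y]].

(* The n-Q properties and the families F_n, C_n only involve the topology, so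
   they are defined for topological spaces; they get applied to subspaces of a
   metric space. *)

Definition F_n (n : nat) (Y : topologicalType) : set (set Y) :=
  [set A | [/\ A !=set0, compact A & A #<= `I_n]].

Definition C_n (n : nat) (Y : topologicalType) : set (set Y) :=
  [set A | [/\ A !=set0, compact A & (connected_component A @` A) #<= `I_n]].

Arguments F_n n {Y}.
Arguments C_n n {Y}.

Definition nQ1 (n : nat) (Y : topologicalType) : Prop :=
  [set: Y] !=set0 /\
  exists2 B : set Y, F_n n B &
    forall x : Y, exists D : set Y,
      [/\ is_continuum D, D° x & B `&` D !=set0].

Definition nQo (n : nat) (Y : topologicalType) : Prop :=
  [set: Y] !=set0 /\
  exists2 B : set Y, F_n n B &
    forall U : set Y, open U -> U !=set0 -> exists D : set Y,
      [/\ is_continuum D, B `&` D° !=set0 & D° `&` U !=set0].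

Definition nQ5 (n : nat) (Y : topologicalType) : Prop :=
  [set: Y] !=set0 /\
  forall UU : set (set Y), finite_set UU ->
    (forall U, UU U -> open U /\ U !=set0) ->
    exists2 D : set Y, C_n n D & forall U, UU U -> D `&` U !=set0.

Definition nQ6 (n : nat) (Y : topologicalType) : Prop :=
  [set: Y] !=set0 /\
  forall U : 'I_n.+1 -> set Y, (forall i, open (U i) /\ U i !=set0) ->
    exists2 D : set Y, C_n n D & forall i, D `&` U i !=set0.

Record hyperspace (R : realType) (X : metricType R) := Hyperspace {
  hyperspace_set :> set X ;
  hyperspace_neq0 : hyperspace_set !=set0 ;
  hyperspace_compact : compact hyperspace_set }.

Definition hausdorff_radii (R : realType) (X : metricType R) (A B : set X)
    : set R :=
  [set r | [/\ 0 < r, A `<=` \bigcup_(b in B) ball b r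
                    & B `<=` \bigcup_(a in A) ball a r]].

Definition hausdorff_dist (R : realType) (X : metricType R) (A B : set X) : R :=
  inf (hausdorff_radii A B).

Section hausdorff_metric.
Context {R : realType} {X : metricType R}.
Implicit Types A B C : hyperspace X.

Lemma hyperspace_inj A B : A = B :> set X -> A = B.
Proof.
case: A B => [A A0 cA] [B B0 cB] /= AB; subst B.
by congr Hyperspace; exact: Prop_irrelevance.
Qed.

Lemma compact_sub_ball (A : set X) (x : X) : compact A ->
  exists2 r : R, 0 < r & A `<=` ball x r.
Proof.
move=> /compact_near_coveringP cA.
have [y _|N _ NA] := cA nat \oo (fun n => ball x n%:R) _.
  pose m := (Num.truncn (mdist x y)).+1.
  exists (ball y 1, [set n | (m.+1 <= n)%N]) => /=.
    by split; [exact: nbhsx_ballx|exists m.+1].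
  move=> [z n] /= [+ mn]; rewrite !ballEmdist/= => yz.
  apply: (le_lt_trans (metric_triangle x y z)).
  apply: (@lt_le_trans _ _ m.+1%:R); last by rewrite ler_nat.
  by rewrite [ltRHS]mulrSr ltrD// truncnS_gt.
exists N.+1%:R => // y Ay.
exact: (NA N.+1 (leqnSn N)).
Qed.

Lemma hausdorff_radii_sym (A B : set X) r :
  hausdorff_radii A B r -> hausdorff_radii B A r.
Proof. by case. Qed.

Lemma hausdorff_radii_neq0 A B : hausdorff_radii A B !=set0.
Proof.
have [a Aa] := hyperspace_neq0 A; have [b Bb] := hyperspace_neq0 B.
have [r r0 Br] := compact_sub_ball a (@hyperspace_compact _ _ B).
have [s s0 As] := compact_sub_ball b (@hyperspace_compact _ _ A).
exists (Num.max r s); split; first by rewrite lt_max r0.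
- by move=> x /As bx; exists b => //; apply: le_ball bx; rewrite le_max lexx orbT.
- by move=> x /Br ax; exists a => //; apply: le_ball ax; rewrite le_max lexx.
Qed.

Lemma hausdorff_radii_inf A B : has_inf (hausdorff_radii A B).
Proof.
by split; [exact: hausdorff_radii_neq0|exists 0 => r [/ltW]].
Qed.

Lemma hausdorff_dist_le A B r : hausdorff_radii A B r ->
  hausdorff_dist A B <= r.
Proof. by move=> ABr; apply: ge_inf => //; have [] := hausdorff_radii_inf A B. Qed.

Lemma hausdorff_dist_adherent A B e : 0 < e ->
  exists2 r, hausdorff_radii A B r & r < hausdorff_dist A B + e.
Proof. by move=> e0; exact: inf_adherent e0 (hausdorff_radii_inf A B). Qed.

Lemma hausdorff_dist_ge0 A B : 0 <= hausdorff_dist A B.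
Proof.
by apply: lb_le_inf; [exact: hausdorff_radii_neq0|move=> r [/ltW]].
Qed.

Lemma hausdorff_distxx A : hausdorff_dist A A = 0.
Proof.
apply/eqP; rewrite eq_le hausdorff_dist_ge0 andbT.
apply/ler_addgt0Pl => e e0; rewrite addr0; apply: hausdorff_dist_le.
by split=> // x Ax; exists x => //; exact: ballxx.
Qed.

Lemma hausdorff_dist_sym A B : hausdorff_dist A B = hausdorff_dist B A.
Proof.
rewrite /hausdorff_dist; congr inf.
by apply/seteqP; split=> r; exact: hausdorff_radii_sym.
Qed.

Lemma hausdorff_dist_triangle B A C :
  hausdorff_dist A C <= hausdorff_dist A B + hausdorff_dist B C.
Proof.
apply/ler_addgt0Pr => e e0.
have e20 : 0 < e / 2 by rewrite divr_gt0.
have [r [r0 AB BA] rlt] := hausdorff_dist_adherent A B e20.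
have [s [s0 BC CB] slt] := hausdorff_dist_adherent B C e20.
rewrite [e]splitr addrACA; apply: (@le_trans _ _ (r + s)); last first.
  by apply: lerD; exact: ltW.
apply: hausdorff_dist_le; split; first exact: addr_gt0.
- move=> a /AB[b Bb bra]; have [c Cc csb] := BC _ Bb.
  by exists c => //; rewrite addrC; exact: ball_triangle csb bra.
- move=> c /CB[b Bb bsc]; have [a Aa arb] := BA _ Bb.
  by exists a => //; exact: ball_triangle arb bsc.
Qed.

Lemma hausdorff_dist_eq0_sub A B : hausdorff_dist A B = 0 -> A `<=` B.
Proof.
move=> AB0 a Aa.
have cB : closed B.
  by apply: compact_closed; [exact: metric_hausdorff|exact: hyperspace_compact].
apply: cB => V /nbhs_ballP[e /= e0 eV].
have [r [r0 AB _]] := hausdorff_dist_adherent A B e0.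
rewrite AB0 add0r => re; have [b Bb bra] := AB _ Aa.
exists b; split => //; apply: eV; apply: (le_ball (ltW re)).
exact: ball_sym.
Qed.

Lemma hausdorff_dist_positivity A B : hausdorff_dist A B = 0 -> A = B.
Proof.
move=> AB0; apply: hyperspace_inj; apply/seteqP.
split; apply: hausdorff_dist_eq0_sub => //.
by rewrite hausdorff_dist_sym.
Qed.

End hausdorff_metric.

HB.instance Definition _ (R : realType) (X : metricType R) :=
  gen_eqMixin (hyperspace X).
HB.instance Definition _ (R : realType) (X : metricType R) :=
  gen_choiceMixin (hyperspace X).
HB.instance Definition _ (R : realType) (X : metricType R) :=
  @isMetric.Build R (hyperspace X)
    (fun A B => hausdorff_dist A B)
    hausdorff_distxx hausdorff_dist_positivity hausdorff_dist_sym
    hausdorff_dist_triangle.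

Definition CC_n (n : nat) (R : realType) (X : metricType R)
    : set (hyperspace X) :=
  [set A : hyperspace X | A = [set: X] :> set X \/ nQ1 n (set_type (~` A))].

Definition NBO_n (n : nat) (R : realType) (X : metricType R)
    : set (hyperspace X) :=
  [set A : hyperspace X | A = [set: X] :> set X \/ nQo n (set_type (~` A))].

Definition S_n (n : nat) (R : realType) (X : metricType R)
    : set (hyperspace X) :=
  [set A : hyperspace X | A = [set: X] :> set X \/ nQ5 n (set_type (~` A))].

Definition NSC_n (n : nat) (R : realType) (X : metricType R)
    : set (hyperspace X) :=
  [set A : hyperspace X | A = [set: X] :> set X \/ nQ6 n (set_type (~` A))].

Arguments CC_n n {R} X.
Arguments NBO_n n {R} X.
Arguments S_n n {R} X.
Arguments NSC_n n {R} X.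

(* Main.v *)
From HB Require Import structures.
Require Import Defs.
From mathcomp Require Import all_boot all_order all_algebra.
From mathcomp Require Import all_classical all_reals all_analysis.
From mathcomp Require Import borel_hierarchy.

Set Implicit Arguments.
Unset Strict Implicit.
Unset Printing Implicit Defensive.

Import Order.TTheory GRing.Theory Num.Theory.
Local Open Scope classical_set_scope.
Local Open Scope card_scope.

(** Fix a countable base [b] of [X]; for [A] in the hyperspace write [Y] for the
    complement of [A], an open subspace of [X].  The idea is to rewrite each of
    the four properties of [Y] without the quantifier over the set [B] of
    [F_n], as a countable conjunction, over tuples [k] of indices of basic open
    sets, of disjunctions: either a closed condition on [A] holds, which makes
    the tuple irrelevant, or [A] is disjoint from some [D] in [C_n] standing in
    a prescribed position with respect to the sets [b (k i)].  By compactness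
    of [A], being contained in a given open set is an open condition on [A];
    hence the second alternative is open, each disjunction is the union of a
    closed and an open set of a metric space, so it is G-delta, and so is the
    countable intersection ([Gdelta_closed_or_avoided]).

    For [nQ5] and [nQ6] the rewriting is immediate: the position is that [D]
    meets every [b (k i)], the closed alternative is that some [b (k i)] lies
    in [A].  For the other two, call two points of [Y] linked when the interior
    of one compact connected set contains both.  This is a partial equivalence
    relation with open classes, and [nQo] says that at most [n] classes cover a
    dense set of points, while [nQ1] says that at most [n] classes cover all of
    [Y].  If a member [D] of [C_n] has [n + 1] given points in its interior,
    two of them lie in the same component of [D]; as [D] has finitely many
    components, these points are interior to that component, so they are
    linked.  Hence (by pigeonhole on classes, [transversal_of_tuples])
    - [nQo] means that for any [n + 1] non-empty open sets some [D] in [C_n] has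
      an interior that meets them all ([nQo_tuples]);
    - [nQ1] follows if any [n + 1] points are interior to some [D] in [C_n]
      ([nQ1_of_tuples]), and implies that every compact set is interior to some
      [D] in [C_n] ([nQ1_compact]).
    In the second case the position is that [D] contains every [b (k i)], and
    the closed alternative is that the closure of some [b (k i)] meets [A]:
    with closures, the compact version of [nQ1] applies; and by regularity
    there are enough basic sets with closure in [Y] to recover the pointwise
    one.

    Since a continuum is required to have two points, isolated points of [Y]
    have to be excluded; a point isolated in [Y] would be isolated in [X],
    which is connected and non-degenerate. *)

(** * Finitely many components *)

Lemma card_le_pigeonhole (T : Type) (A : set T) (n : nat) :
  A #<= `I_n <->
  forall f : 'I_n.+1 -> T, (forall i, A (f i)) ->
    exists i j, i <> j /\ f i = f j.
Proof.
split=> [An f Af|AP].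
  apply: contrapT => /forallNP finj.
  have f_inj : {in [set: 'I_n.+1] &, injective f}.
    move=> i j _ _ fij; apply: contrapT => nij.
    by apply: (finj i); exists j.
  have : [set: 'I_n.+1] #<= `I_n.
    rewrite -(card_le_eql (inj_card_eq f_inj)).
    apply: card_le_trans An; apply: subset_card_le.
    by move=> _ [i _ <-]; exact: Af.
  by rewrite -(card_le_eql card_II) card_le_II ltnn.
apply: contrapT => nAn.
have : [set: 'I_n.+1] #<= A.
  rewrite -(card_le_eql card_II).
  have [[m Am]|/infiniteP] := pselect (finite_set A); last first.
    by apply: card_le_trans; exact: card_leT.
  rewrite (card_le_eqr Am) card_le_II ltnNge; apply/negP => mn.
  by apply: nAn; rewrite (card_le_eql Am) card_le_II.
move=> /pfcard_geP[/seteqP[/(_ ord0 I)//]|/surjfunPex[g gA]].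
have /choice[f fP] : forall i, exists x, A x /\ g x = i.
  by move=> i; have : [set: 'I_n.+1] i by []; rewrite gA => -[x]; exists x.
have [|i [j [ij fij]]] := AP f; first by move=> i; case: (fP i).
by apply: ij; rewrite -(fP i).2 fij (fP j).2.
Qed.

Section finitely_many_components.
Context {Y : topologicalType}.
Implicit Types A B D K : set Y.

Lemma connected_component_subset A B x : A `<=` B ->
  connected_component A x `<=` connected_component B x.
Proof.
by move=> AB y [C [Cx CA Cc] Cy]; exists C => //; split=> //; apply: subset_trans AB.
Qed.

(** This form mentions only connected subsets of [A], so that it passes to and
    from subspaces without comparing sets of components. *)
Lemma C_nP n A : C_n n A <->
  [/\ A !=set0, compact A & forall f : 'I_n.+1 -> Y, (forall i, A (f i)) ->
    exists i j, i <> j /\ connected_component A (f i) (f j)].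
Proof.
split=> [[A0 cA /card_le_pigeonhole An]|[A0 cA An]]; split=> //.
  move=> f Af; have [|i [j [ij cij]]] := An (connected_component A \o f).
    by move=> i /=; exists (f i).
  exists i, j; split=> //; move: cij => /= ->.
  exact: connected_component_refl.
apply/card_le_pigeonhole => g gA.
have /choice[f fP] : forall i, exists x, A x /\ connected_component A x = g i.
  by move=> i; have [x Ax <-] := gA i; exists x.
have [|i [j [ij cij]]] := An f; first by move=> i; case: (fP i).
exists i, j; split=> //; rewrite -(fP i).2 -(fP j).2.
exact: same_connected_component.
Qed.

(** Every continuum of the covering meets [B], so each component of a union of
    such continua contains a point of [B] and there are at most [n] of them.
    Compactness of [K] enters as the near-covering property for the filter
    generated by the sets all of whose components meet [B]. *)
Lemma cover_by_continua n B K : F_n n B -> compact K ->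
  (forall x, K x -> exists D,
    [/\ compact D, connected D, D° x & B `&` D !=set0]) ->
  exists2 D, C_n n D & K `<=` D°.
Proof.
move=> [[b0 Bb0] cB Bn] /compact_near_coveringP cK KD.
pose good D := compact D /\
  forall y, D y -> exists2 b, B b & connected_component D y b.
have good0 : good set0 by split; [exact: compact0|].
have goodB : good B.
  by split=> // y By; exists y => //; exact: connected_component_refl.
have goodU D E : good D -> good E -> good (D `|` E).
  move=> [cD DB] [cE EB]; split; first exact: compactU.
  by move=> y [/DB|/EB] [b Bb yb]; exists b => //;
    apply: connected_component_subset yb; [left|right].
pose F := filter_from good (fun D => [set E | D `<=` E]).
have FF : Filter F.
  apply: filter_from_filter; first by exists set0.
  move=> D E gD gE; exists (D `|` E); first exact: goodU.
  by move=> G DEG; split => x ?; apply: DEG; [left|right].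
have [x Kx|D gD DK] := cK _ F (fun E x => E° x) FF.
  have [D [cD kD Dx [b [Bb Db]]]] := KD x Kx.
  exists (D°, [set E | D `<=` E]).
    split; first by apply: open_nbhs_nbhs; split => //; exact: open_interior.
    exists D => //; split=> // y Dy; exists b => //.
    by rewrite connected_component_id.
  by move=> [y E] /= [Dy DE]; exact: interiorS Dy.
have [cDB DBB] := goodU _ _ gD goodB.
(* [K] may be empty: adding [B] keeps the witness non-empty. *)
exists (D `|` B).
  split=> //; first by exists b0; right.
  apply: card_le_trans Bn.
  apply: (@card_le_trans _ _ _ (connected_component (D `|` B) @` B)); last first.
    exact: card_image_le.
  apply: subset_card_le => _ [y Dy <-]; have [b Bb yb] := DBB _ Dy.
  by exists b => //; exact/esym/same_connected_component.
by apply: DK => x Dx; left.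
Qed.

Hypothesis hausY : hausdorff_space Y.

(** The other components of [D] are closed and finitely many, so that each
    component is open relatively to [D]. *)
Lemma component_interior n D x : C_n n D -> D° x ->
  (connected_component D x)° x.
Proof.
move=> [_ cD Dn] Dx; have clD := compact_closed hausY cD.
pose O := [set E | (connected_component D @` D) E /\ ~ E x].
pose K := \bigcup_(E in O) E.
have cK : closed K.
  apply: closed_bigcup.
    apply: (@sub_finite_set _ _ (connected_component D @` D)).
      by move=> E [].
    by apply/finite_set_leP; exists n.
  by move=> _ [[y Dy <-] _]; exact: component_closed.
have nK : nbhs x (~` K).
  apply: open_nbhs_nbhs; split; first exact: closed_openC.
  by move=> [E [_ nEx]].
apply: filterS (filterI Dx nK) => y [Dy nKy].
apply: contrapT => nxy; apply: nKy.
exists (connected_component D y); last exact: connected_component_refl.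
split; first by exists y.
by move=> /connected_component_sym.
Qed.

End finitely_many_components.

(** * Linked points and tuple forms of nQ1 and nQo *)

Section transversals.
Context {Y : topologicalType}.
Implicit Types B D K U V : set Y.

(** Asking for interiors makes the relation transitive with open classes; it is
    reflexive exactly at the points that have a compact connected
    neighbourhood. *)
Definition linked (x y : Y) : Prop :=
  exists D, [/\ compact D, connected D, D° x & D° y].

Lemma linked_sym x y : linked x y -> linked y x.
Proof. by move=> [D [*]]; exists D. Qed.

Lemma linked_trans y x z : linked x y -> linked y z -> linked x z.
Proof.
move=> [D [cD kD Dx Dy]] [E [cE kE Ey Ez]]; exists (D `|` E).
split; first exact: compactU.
- by apply: connectedU => //; exists y; split; exact: interior_subset.
- by apply: interiorS Dx; exact: subsetUl.
- by apply: interiorS Ez; exact: subsetUr.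
Qed.

Lemma linked_class x y : linked x y -> linked x = linked y.
Proof.
move=> xy; apply/seteqP; split=> z; last exact: linked_trans xy.
exact: linked_trans (linked_sym xy).
Qed.

Lemma linked_open x : open (linked x).
Proof.
rewrite openE => y [D [cD kD Dx Dy]].
have : nbhs y D° by apply: open_nbhs_nbhs; split => //; exact: open_interior.
by apply: filterS => z Dz; exists D.
Qed.

Hypothesis hausY : hausdorff_space Y.
Hypothesis no_isolated : forall x : Y, ~ open [set x].

Lemma continuum_of_interior D x :
  compact D -> connected D -> D° x -> is_continuum D.
Proof.
move=> cD kD Dx; split=> //; have xD := interior_subset Dx.
apply: contrapT => /forallNP Dsing; apply: (@no_isolated x).
rewrite openE => _ ->; apply: filterS Dx => y Dy.
by apply: contrapT => yx; apply: (Dsing y); exists x.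
Qed.

Lemma same_component_linked n D x y : C_n n D -> D° x -> D° y ->
  connected_component D x y -> linked x y.
Proof.
move=> CD Dx Dy xy; have [_ cD _] := CD.
exists (connected_component D x); split.
- apply: (subclosed_compact _ cD); last exact: connected_component_sub.
  exact/component_closed/(compact_closed hausY cD).
- exact: component_connected.
- exact: component_interior CD Dx.
- by rewrite (same_connected_component xy); exact: component_interior CD Dy.
Qed.

(** [F] is a family of test sets: the singletons for [nQ1], the non-empty open
    sets for [nQo].  If there were [n + 1] classes of linked points, test sets
    taken inside these classes would be met by the interior of one [D] in
    [C_n], two of them inside the same component, which would link two distinct
    classes.  A transversal of the classes can thus serve as [B]: the interior
    of a set [D] meets any given test set, at a point which is then linked to
    itself and to the representative of its class. *)
Lemma transversal_of_tuples n (F : set (set Y)) : F !=set0 ->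
  (forall x, linked x x -> exists2 U, F U & U `<=` linked x) ->
  (forall U : 'I_n.+1 -> set Y, (forall i, F (U i)) ->
    exists2 D, C_n n D & forall i, D° `&` U i !=set0) ->
  exists2 B, F_n n B & forall U, F U -> exists D,
    [/\ is_continuum D, B `&` D° !=set0 & D° `&` U !=set0].
Proof.
move=> [U0 FU0] Flinked Ftuple; pose W := [set x | linked x x].
have meetW U : F U -> exists2 y, W y & U y.
  move=> FU; have [//|D CD DU] := Ftuple (fun=> U); have [y [Dy Uy]] := DU ord0.
  exists y => //; apply: (same_component_linked CD Dy Dy).
  exact/connected_component_refl/(interior_subset Dy).
have few : linked @` W #<= `I_n.
  apply/card_le_pigeonhole => f fW.
  have /choice[x fx] : forall i, exists x, W x /\ linked x = f i.
    by move=> i; have [x Wx fx] := fW i; exists x.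
  have /choice[U FU] : forall i, exists U, F U /\ U `<=` linked (x i).
    move=> i; have /Flinked[U FU Ux] : linked (x i) (x i) by case: (fx i).
    by exists U.
  have [|D CD DU] := Ftuple U; first by move=> i; case: (FU i).
  have /choice[y yDU] := DU; have [_ _ Dn] := (C_nP n D).1 CD.
  have [|i [j [ij cij]]] := Dn y.
    by move=> i; have [/interior_subset] := yDU i.
  exists i, j; split=> //.
  have [_ <-] := fx i; have [_ <-] := fx j.
  have xy k : linked (x k) (y k) by have [_] := FU k; apply; case: (yDU k).
  rewrite (linked_class (xy i)) (linked_class (xy j)); apply: linked_class.
  by apply: same_component_linked CD _ _ cij; [case: (yDU i)|case: (yDU j)].
have [y0 Wy0 _] := meetW _ FU0.
have /choice[rep repP] : forall C, exists x, (linked @` W) C -> linked x = C.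
  move=> C; have [[x _ <-]|nC] := pselect ((linked @` W) C); first by exists x.
  by exists y0.
have Bn : rep @` (linked @` W) #<= `I_n.
  exact: card_le_trans (card_image_le _ _) few.
exists (rep @` (linked @` W)).
  split=> //; first by exists (rep (linked y0)), (linked y0) => //; exists y0.
  by apply: finite_compact; apply/finite_set_leP; exists n.
move=> U /meetW[y Wy Uy]; have Wly : (linked @` W) (linked y) by exists y.
have : linked (rep (linked y)) y by rewrite (repP _ Wly).
move=> [D [cD kD Db Dy]]; exists D; split.
- exact: continuum_of_interior Dy.
- by exists (rep (linked y)); split=> //; exists (linked y).
- by exists y.
Qed.

(** Every point has a compact connected neighbourhood meeting the same [n]
    points. *)
Lemma nQ1_compact n : nQ1 n Y ->
  forall K, compact K -> exists2 D, C_n n D & K `<=` D°.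
Proof.
move=> [_ [B FB BD]] K cK; apply: cover_by_continua FB cK _ => x _.
by have [D [[cD kD _] Dx D0]] := BD x; exists D.
Qed.

Lemma nQ1_of_tuples n : [set: Y] !=set0 ->
  (forall x : 'I_n.+1 -> Y, exists2 D, C_n n D & forall i, D° (x i)) ->
  nQ1 n Y.
Proof.
move=> [y0 _] xD; split; first by exists y0.
have [|||B FB BD] := @transversal_of_tuples n (range set1).
- by exists [set y0], y0.
- by move=> x lx; exists [set x]; [exists x|move=> z /= ->].
- move=> U rU; have /choice[x xU] : forall i, exists x, [set x] = U i.
    by move=> i; have [x _ <-] := rU i; exists x.
  have [D CD Dx] := xD x; exists D => // i.
  by exists (x i); split=> //; rewrite -xU.
exists B => // x; have [|D [cD [b [Bb Db]] [z [Dz zx]]]] := BD [set x].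
  by exists x.
rewrite /= in zx; subst z.
by exists D; split=> //; exists b; split=> //; exact: interior_subset.
Qed.

(** From left to right, pick in each open set a point interior to a continuum
    that meets [B], and cover the finite set of these points. *)
Lemma nQo_tuples n : nQo n Y <-> [set: Y] !=set0 /\
  forall U : 'I_n.+1 -> set Y, (forall i, open (U i) /\ U i !=set0) ->
    exists2 D, C_n n D & forall i, D° `&` U i !=set0.
Proof.
split=> [[Y0 [B FB BD]]|[Y0 UD]]; split=> //.
  move=> U U0.
  have /choice[x xP] : forall i, exists x, U i x /\ exists D,
      [/\ compact D, connected D, D° x & B `&` D !=set0].
    move=> i; have [D [[cD kD _] [b [Bb Db]] [x [Dx Ux]]]] :=
      BD (U i) (U0 i).1 (U0 i).2.
    exists x; split=> //; exists D; split=> //.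
    by exists b; split=> //; exact: interior_subset.
  have crx : compact (range x).
    by apply: finite_compact; apply: finite_image; exact: finite_finset.
  have [|D CD xD] := cover_by_continua FB crx.
    by move=> _ [i _ <-]; case: (xP i).
  by exists D => // i; exists (x i); split; [apply: xD; exists i|case: (xP i)].
have [|||B FB BD] := @transversal_of_tuples n [set U | open U /\ U !=set0].
- by exists setT; split => //; exact: openT.
- move=> x lx; exists (linked x) => //; split; first exact: linked_open.
  by exists x.
- exact: UD.
by exists B => // U oU U0; exact: BD.
Qed.

End transversals.

(** * Transfer between a subspace and the ambient space *)

Section subtype.
Context {X : topologicalType} (U : set X).
Local Notation Y := (set_type U).

Lemma val_continuous : continuous (val : Y -> X).
Proof. exact: initial_continuous. Qed.

Lemma val_in (y : Y) : U (val y).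
Proof. exact: set_valP. Qed.

Lemma val_image_sub (D : set Y) : val @` D `<=` U.
Proof. by move=> _ [y _ <-]; exact: val_in. Qed.

Lemma val_lift x : U x -> exists y : Y, val y = x.
Proof. by move=> Ux; exists (SigSub (mem_set Ux)). Qed.

Lemma val_image_preimage (K : set X) : K `<=` U ->
  val @` (val @^-1` K : set Y) = K.
Proof.
move=> KU; apply/seteqP; split=> [_ [y Ky <-]//|x Kx].
by have [y yx] := val_lift (KU _ Kx); exists y => //=; rewrite yx.
Qed.

Lemma val_hausdorff : hausdorff_space X -> hausdorff_space Y.
Proof.
move=> hX p q pq; apply: val_inj; apply: hX => A B pA qB.
have [y [Ay By]] := pq _ _ (val_continuous pA) (val_continuous qB).
by exists (val y).
Qed.

Lemma compact_val (K : set Y) : compact K -> compact (val @` K).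
Proof.
by apply: continuous_compact; apply: continuous_subspaceT; exact: val_continuous.
Qed.

Lemma connected_val (K : set Y) : connected K -> connected (val @` K).
Proof.
move=> cK; apply: connected_continuous_connected => //.
by apply: continuous_subspaceT; exact: val_continuous.
Qed.

Lemma compact_preval (K : set X) : K `<=` U -> compact K ->
  compact (val @^-1` K : set Y).
Proof.
move=> KU cK F FF FK.
have [x [Kx Fx]] := cK (val @ F) _ FK.
have [y yx] := val_lift (KU _ Kx); exists y; split; first by rewrite /= yx.
move=> A B FA; rewrite nbhsE => -[_ [[W oW <-] Wy] WB].
have FvA : (val @ F) (val @` A).
  by rewrite /= nbhs_simpl; apply: filterS FA => a Aa; exists a.
have xW : nbhs x W by apply: open_nbhs_nbhs; split => //; rewrite -yx.
have [_ [[a Aa <-] Wa]] := Fx _ _ FvA xW.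
by exists a; split=> //; exact: WB.
Qed.

(** A relatively clopen part of the preimage is the trace of an open set and of
    a closed set of the ambient space, so its image is relatively clopen in
    [K]. *)
Lemma connected_preval (K : set X) : K `<=` U -> connected K ->
  connected (val @^-1` K : set Y).
Proof.
move=> KU cK B [b Bb] [_ [W oW <-] BW] [C cC BC].
have [_ [V oV VC]] := conj I (closed_openC cC).
have BK : val @` B `<=` K by move=> _ [y + <-]; rewrite BW => -[].
suff vB : val @` B = K.
  apply/seteqP; split; first by rewrite BW => y [].
  move=> y Ky; have : (val @` B) (val y) by rewrite vB.
  by move=> [z Bz /val_inj <-].
apply: cK.
- by exists (val b); exists b.
- exists W => //; apply/seteqP; split=> [_ [y + <-]|x [Kx Wx]].
    by rewrite BW => -[].
  have [y yx] := val_lift (KU _ Kx); subst x; exists y => //.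
  by rewrite BW.
- exists (~` V); first exact: open_closedC.
  have CE y : C y <-> ~ V (val y).
    by rewrite -[V (val y)]/((val @^-1` V : set Y) y) VC /setC /= notK.
  apply/seteqP; split=> [_ [y By <-]|x [Kx Wx]].
    by split; [apply: BK; exists y|apply/CE; move: By; rewrite BC => -[]].
  have [y yx] := val_lift (KU _ Kx); subst x; exists y => //.
  by rewrite BC; split=> //; exact/CE.
Qed.

Lemma C_n_val n (D : set Y) : C_n n D -> C_n n (val @` D).
Proof.
move=> /C_nP[[y Dy] cD Dn]; apply/C_nP; split.
- by exists (val y); exists y.
- exact: compact_val.
move=> f fD; have /choice[g gP] : forall i, exists y, D y /\ val y = f i.
  by move=> i; have [z Dz <-] := fD i; exists z.
have [|i [j [ij [C [Ci CD kC Cj]]]]] := Dn g; first by move=> i; case: (gP i).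
exists i, j; split=> //; exists (val @` C).
  split; last exact: connected_val.
  - by exists (g i) => //; case: (gP i).
  - exact: image_subset.
by exists (g j) => //; case: (gP j).
Qed.

Lemma C_n_preval n (D : set X) : D `<=` U -> C_n n D ->
  C_n n (val @^-1` D : set Y).
Proof.
move=> DU /C_nP[[x Dx] cD Dn]; apply/C_nP; split.
- by have [y yx] := val_lift (DU _ Dx); exists y; rewrite /= yx.
- exact: compact_preval.
move=> f fD; have [|i [j [ij [C [Ci CD kC Cj]]]]] := Dn (val \o f) => //.
exists i, j; split=> //; exists (val @^-1` C) => //; split=> //.
  by move=> y /CD.
by apply: connected_preval => //; exact: subset_trans DU.
Qed.

Lemma interior_preval (D : set X) (y : Y) : D° (val y) ->
  (val @^-1` D : set Y)° y.
Proof. exact: val_continuous. Qed.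

Hypothesis oU : open U.

Lemma open_val (V : set Y) : open V -> open (val @` V).
Proof.
move=> [W oW <-]; rewrite (_ : _ @` _ = W `&` U); first exact: openI.
apply/seteqP; split=> [_ [y Wy <-]|x [Wx Ux]].
  by split=> //; exact: val_in.
by have [y yx] := val_lift Ux; subst x; exists y.
Qed.

Lemma interior_val (D : set Y) (y : Y) : (val @` D)° (val y) <-> D° y.
Proof.
split=> [/interior_preval|Dy].
  by apply: interiorS => z [w Dw /val_inj <-].
have : (val @` D°) `<=` (val @` D)°.
  rewrite -open_subsetE; last exact/open_val/open_interior.
  by apply: image_subset; exact: interior_subset.
by apply; exists y.
Qed.

Lemma no_isolated_subtype :
  (forall x : X, ~ open [set x]) -> forall y : Y, ~ open [set y].
Proof.
move=> niX y /open_val oy; apply: (niX (val y)).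
by rewrite image_set1 in oy.
Qed.

End subtype.

(** * G-delta sets of the hyperspace *)

Section Gdelta_sets.

Lemma Gdelta_bigcap (T : topologicalType) (J : countType) (G : J -> set T) :
  (forall i, Gdelta (G i)) -> Gdelta (\bigcap_i G i).
Proof.
move=> GG; have /choice[F FP] : forall i, exists F : nat -> set T,
    (forall j, open (F j)) /\ G i = \bigcap_j F j.
  by move=> i; have [F oF GF] := GG i; exists F.
pose H k := if @unpickle (J * nat)%type k is Some ij then F ij.1 ij.2 else setT.
exists H => [k|].
  by rewrite /H; case: unpickle => [ij|]; [exact: (FP _).1|exact: openT].
apply/seteqP; split=> [x Gx k _|x Hx i _].
  rewrite /H; case: unpickle => // -[i j] /=.
  by have := Gx i I; rewrite (FP i).2; exact.
rewrite (FP i).2 => j _.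
by have := Hx (pickle (i, j)) I; rewrite /H pickleK.
Qed.

(** A closed set is the intersection of its neighbourhoods of radius
    [1 / (m + 1)]; the open set [O] is added to each of these. *)
Lemma Gdelta_closedU_open (R : realType) (T : pseudoMetricType R)
    (C O : set T) : closed C -> open O -> Gdelta (C `|` O).
Proof.
move=> cC oO; exists (fun m => (\bigcup_(a in C) (ball a m.+1%:R^-1)°) `|` O).
  by move=> m; apply: openU => //; apply: bigcup_open => a _; exact: open_interior.
apply/seteqP; split=> [x [Cx|Ox] m _|x Hx]; last 1 first.
- have [Ox|nOx] := pselect (O x); first by right.
  left; apply: cC => V /nbhs_ballP[e /= e0 eV].
  have [m _ /(_ m (leqnn m)) me] := near_infty_natSinv_lt (PosNum e0).
  have [[a Ca xa]|//] := Hx m I; exists a; split=> //.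
  apply: eV; apply: ball_sym; apply: le_ball (interior_subset xa).
  exact: ltW.
- left; exists x => //.
  by apply: nbhsx_ballx; rewrite invr_gt0 ltr0n.
- by right.
Qed.

Lemma closed_exists (T : topologicalType) (m : nat) (C : 'I_m -> set T) :
  (forall i, closed (C i)) -> closed [set x | exists i, C i x].
Proof.
move=> cC; rewrite (_ : mkset _ = \bigcup_i C i).
  by apply: closed_bigcup => [|i _]; [exact: finite_finset|exact: cC].
by apply/seteqP; split=> x [i]; exists i.
Qed.

End Gdelta_sets.

Section hyperspace_topology.
Context {R : realType} {X : metricType R}.

Lemma compact_ball_sub (A U : set X) : compact A -> open U -> A `<=` U ->
  exists2 e : R, (0 < e)%R & forall a, A a -> ball a e `<=` U.
Proof.
move=> /compact_near_coveringP cA oU AU.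
have [x Ax|N _ NA] := cA nat \oo (fun m a => ball a (m.+1%:R^-1 : R)%R `<=` U) _.
  have /nbhs_ballP[e /= e0 eU] : nbhs x U.
    by apply: open_nbhs_nbhs; split=> //; exact: AU.
  have e20 : (0 < e / 2)%R by rewrite divr_gt0.
  exists (ball x (e / 2)%R, [set m | m.+1%:R^-1 < e / 2]%R).
    by split; [exact: nbhsx_ballx|exact: (near_infty_natSinv_lt (PosNum e20))].
  move=> [a m] /= [xa me] z az; apply: eU.
  rewrite [e]splitr; apply: ball_triangle xa _.
  by apply: le_ball az; exact: ltW.
by exists N.+1%:R^-1%R; [rewrite invr_gt0 ltr0n|exact: NA (leqnn N)].
Qed.

(** The basic open condition on [A], from which the other ones derive: a compact
    [A] inside [U] keeps a positive distance from the complement of [U]. *)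
Lemma open_hyperspace_sub (U : set X) : open U ->
  open [set A : hyperspace X | A `<=` U].
Proof.
move=> oU; rewrite openE => A /= AU.
have [e e0 eU] := compact_ball_sub (@hyperspace_compact _ _ A) oU AU.
apply/nbhs_ballP; exists e => // B; rewrite ballEmdist /= => ABe.
have de0 : (0 < e - hausdorff_dist A B)%R by rewrite subr_gt0.
have [r [r0 _ BA]] := hausdorff_dist_adherent A B de0.
rewrite addrC subrK => re b /BA[a Aa ab].
by apply: (eU a Aa); apply: le_ball ab; exact: ltW.
Qed.

Lemma closed_hyperspace_meet (K : set X) : closed K ->
  closed [set A : hyperspace X | A `&` K !=set0].
Proof.
move=> cK; rewrite (_ : mkset _ = ~` [set A : hyperspace X | A `<=` ~` K]).
  by apply: open_closedC; apply: open_hyperspace_sub; exact: closed_openC.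
apply/seteqP; split=> [A [x [Ax Kx]] /(_ x Ax)//|A /= nAK].
apply: contrapT => AK; apply: nAK => x Ax Kx.
by apply: AK; exists x.
Qed.

(** Containing [V] means meeting every singleton of a point of [V]. *)
Lemma closed_hyperspace_sup (V : set X) :
  closed [set A : hyperspace X | V `<=` A].
Proof.
rewrite (_ : mkset _ =
    \bigcap_(v in V) [set A : hyperspace X | A `&` [set v] !=set0]).
  apply: closed_bigI => v _; apply: closed_hyperspace_meet.
  exact/accessible_closed_set1/hausdorff_accessible/metric_hausdorff.
apply/seteqP; split=> [A VA v Vv|A VA v Vv].
  by exists v; split=> //; exact: VA.
by have [x [Ax xv]] := VA v Vv; move: Ax; rewrite xv.
Qed.

Lemma closed_hyperspace_full :
  closed [set A : hyperspace X | A = [set: X] :> set X].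
Proof.
rewrite (_ : mkset _ = [set A : hyperspace X | [set: X] `<=` A]).
  exact: closed_hyperspace_sup.
by apply/seteqP; split=> [A /= ->//|A TA]; exact/seteqP.
Qed.

Definition avoided_by (n : nat) (P : set X -> Prop) : set (hyperspace X) :=
  [set A | exists2 D, C_n n D /\ D `<=` ~` A & P D].

Lemma open_avoided_by n (P : set X -> Prop) : open (avoided_by n P).
Proof.
rewrite (_ : avoided_by n P = \bigcup_(D in [set D | C_n n D /\ P D])
    [set A : hyperspace X | A `<=` ~` D]).
  apply: bigcup_open => D [[_ cD _] _]; apply: open_hyperspace_sub.
  exact/closed_openC/(compact_closed (@metric_hausdorff _ _) cD).
apply/seteqP; split=> [A [D [CD DA] PD]|A [D [CD PD] AD]].
  by exists D => // x Ax /DA.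
by exists D => //; split=> // x Dx /AD.
Qed.

(** Since being the full set is a closed condition, it can be absorbed in each
    of the closed alternatives. *)
Lemma Gdelta_closed_or_avoided (J : countType) n
    (C : J -> set (hyperspace X)) (P : J -> set X -> Prop) :
  (forall i, closed (C i)) ->
  Gdelta [set A : hyperspace X | A = [set: X] :> set X \/
    forall i, C i A \/ avoided_by n (P i) A].
Proof.
move=> cC; rewrite (_ : mkset _ = \bigcap_i
    (([set A : hyperspace X | A = [set: X] :> set X] `|` C i) `|`
     avoided_by n (P i))).
  apply: Gdelta_bigcap => i; apply: Gdelta_closedU_open.
    by apply: closedU => //; exact: closed_hyperspace_full.
  exact: open_avoided_by.
apply/seteqP; split=> [A [AT i _|AP i _]|A AP].
- by left; left.
- by case: (AP i); [left; right|right].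
- have [AT|nAT] := pselect (A = [set: X] :> set X); first by left.
  by right=> i; have [[//|]|] := AP i I; [left|right].
Qed.

End hyperspace_topology.

(** * The four properties of a complement in terms of basic open sets *)

Lemma countable_base_enum (T : topologicalType) : @second_countable T ->
  exists b : nat -> set T, (forall k, open (b k)) /\
    forall x U, nbhs x U -> exists2 k, b k x & b k `<=` U.
Proof.
move=> [B /pfcard_geP[B0|[f]] [oB bB]].
  exists (fun=> set0); split=> [_|x U /bB[V []]]; first exact: open0.
  by rewrite B0.
exists f; split=> [k|x U /bB[V [BV Vx] VU]].
  by apply: oB; exact: funS.
have [k _ fk] := 'surj_f BV.
by exists k; rewrite fk.
Qed.

Section complement_of_hyperpoint.
Context {R : realType} {X : metricType R}.
Variables (n : nat) (b : nat -> set X).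
Hypothesis ob : forall k, open (b k).
Hypothesis bP : forall x U, nbhs x U -> exists2 k, b k x & b k `<=` U.
Hypothesis ctX : is_continuum [set: X].

Implicit Type A : hyperspace X.
Local Notation Y A := (set_type (~` (A : set X))).

Lemma continuum_no_isolated (x : X) : ~ open [set x].
Proof.
move=> ox; have [_ kX [y [z [_ _ yz]]]] := ctX.
have xT : [set x] = [set: X].
  apply: kX; first by exists x.
    by exists [set x] => //; rewrite setTI.
  exists [set x]; last by rewrite setTI.
  exact/accessible_closed_set1/hausdorff_accessible/metric_hausdorff.
by apply: yz; have : [set: X] y by []; have : [set: X] z by [];
  rewrite -xT => -> ->.
Qed.

Lemma hyperspace_openC A : open (~` (A : set X)).
Proof.
apply: closed_openC; apply: compact_closed; first exact: metric_hausdorff.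
exact: hyperspace_compact.
Qed.

Lemma complement_hausdorff A : hausdorff_space (Y A).
Proof. by apply: val_hausdorff; exact: metric_hausdorff. Qed.

Lemma complement_no_isolated A (y : Y A) : ~ open [set y].
Proof.
exact: no_isolated_subtype (hyperspace_openC A) continuum_no_isolated y.
Qed.

Lemma complement_neq0 A : A <> [set: X] :> set X -> [set: Y A] !=set0.
Proof.
move=> AT; apply: contrapT => Y0; apply: AT; apply/seteqP; split=> // x _.
apply: contrapT => nAx; apply: Y0.
by have [y _] := @val_lift _ (~` (A : set X)) x nAx; exists y.
Qed.

Lemma full_or_congr A (P Q : Prop) :
  (A <> [set: X] :> set X -> P <-> Q) ->
  (A = [set: X] :> set X \/ P) <-> (A = [set: X] :> set X \/ Q).
Proof.
move=> PQ; split=> -[AT|p]; try (by left);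
  by have [AT|/PQ[pq qp]] := pselect (A = [set: X] :> set X); [left|right; auto].
Qed.

(** The pair [opX], [opY] stands for the identities (for [nQ5] and [nQ6]) or for
    the interiors (for [nQo]).  A basic set not contained in [A] has a non-empty
    trace on the complement, and conversely every non-empty open set of the
    complement, being open in [X], contains a non-empty basic set. *)
Lemma open_tuplesP A m (opX : set X -> set X) (opY : set (Y A) -> set (Y A)) :
  (forall D y, opX (val @` D) (val y) <-> opY D y) ->
  (forall U : 'I_m -> set (Y A), (forall i, open (U i) /\ U i !=set0) ->
    exists2 D, C_n n D & forall i, opY D `&` U i !=set0) <->
  (forall k : {ffun 'I_m -> nat}, (exists i, b (k i) `<=` A) \/
    avoided_by n (fun D => forall i, opX D `&` b (k i) !=set0) A).
Proof.
move=> opXY; split=> [UD k|kD U U0].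
  have [kA|nkA] := pselect (exists i, b (k i) `<=` A); [by left|right].
  have [i|D CD DU] := UD (fun i => val @^-1` b (k i)).
    split; first by have /continuousP := @val_continuous _ (~` (A : set X)); exact.
    apply: contrapT => bk0; apply: nkA; exists i => x bx.
    apply: contrapT => nAx; apply: bk0.
    by have [y yx] := @val_lift _ (~` (A : set X)) x nAx; exists y; rewrite /= yx.
  exists (val @` D); first by split; [exact: C_n_val|exact: val_image_sub].
  by move=> i; have [y [Dy by_]] := DU i; exists (val y); split => //; exact/opXY.
have /choice[k kP] : forall i, exists k, b k !=set0 /\
    b k `<=` val @` U i.
  move=> i; have [oU [y Uy]] := U0 i.
  have [|k bky bkU] := @bP (val y) (val @` U i).
    apply: open_nbhs_nbhs; split; last by exists y.
    exact: open_val (hyperspace_openC A) _ oU.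
  by exists k; split=> //; exists (val y).
have [[i]|[D [CD DA] Dk]] := kD [ffun i => k i].
  rewrite ffunE; have [[x bx] bU] := kP i.
  by move=> /(_ x bx); have [y _ <-] := bU x bx; have := val_in y.
exists (val @^-1` D); first exact: C_n_preval.
move=> i; have [x [Dx]] := Dk i; rewrite ffunE => bx.
have [y Uy yx] := (kP i).2 x bx; subst x.
by exists y; split=> //; apply/opXY; rewrite val_image_preimage.
Qed.

(** The closures make the left-to-right direction work: if they all miss [A],
    their union is a compact subset of the complement, to which [nQ1_compact]
    applies. *)
Lemma nQ1_complement A : A <> [set: X] :> set X ->
  nQ1 n (Y A) <->
  forall k : {ffun 'I_n.+1 -> nat},
    (exists i, A `&` closure (b (k i)) !=set0) \/
    avoided_by n (fun D => forall i, b (k i) `<=` D) A.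
Proof.
move=> /complement_neq0 Y0; split=> [QY k|kD].
  have [kA|nkA] := pselect (exists i, A `&` closure (b (k i)) !=set0).
    by left.
  right; pose K := \bigcup_i closure (b (k i)).
  have cK : compact K.
    have [cX _ _] := ctX; apply: (subclosed_compact _ cX) => //.
    apply: closed_bigcup => [|i _]; first exact: finite_finset.
    exact: closed_closure.
  have KA : K `<=` ~` A by move=> x [i _ bx] Ax; apply: nkA; exists i, x.
  have [D CD KD] := nQ1_compact QY (compact_preval KA cK).
  exists (val @` D); first by split; [exact: C_n_val|exact: val_image_sub].
  move=> i x bx; have Kx : K x by exists i => //; exact: subset_closure.
  have [y yx] := val_lift (KA _ Kx); subst x.
  by exists y => //; apply: interior_subset; exact: KD.
apply: nQ1_of_tuples => //.
- exact: complement_hausdorff.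
- exact: complement_no_isolated.
move=> x; have /choice[k kP] : forall i, exists k,
    b k (val (x i)) /\ closure (b k) `<=` ~` A.
  move=> i; have nA : nbhs (val (x i)) (~` (A : set X)).
    by apply: open_nbhs_nbhs; split; [exact: hyperspace_openC|exact: val_in].
  have [V nV VA] := @uniform_regular X (val (x i)) _ nA.
  have [k bx bV] := bP nV; exists k; split=> //.
  exact: subset_trans (closureS bV) VA.
have [[i [z []]]|[D [CD DA] Dk]] := kD [ffun i => k i].
  by rewrite ffunE => Az /(kP i).2.
exists (val @^-1` D); first exact: C_n_preval.
move=> i; apply: interior_preval; have := Dk i; rewrite ffunE => bD.
apply: filterS bD _; apply: open_nbhs_nbhs; split; first exact: ob.
by case: (kP i).
Qed.

Lemma nQo_complement A : A <> [set: X] :> set X ->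
  nQo n (Y A) <->
  forall k : {ffun 'I_n.+1 -> nat}, (exists i, b (k i) `<=` A) \/
    avoided_by n (fun D => forall i, D° `&` b (k i) !=set0) A.
Proof.
move=> /complement_neq0 Y0.
rewrite -(@open_tuplesP A _ (@interior X) (@interior (Y A))).
- rewrite nQo_tuples; first by split=> [[]|].
  + exact: complement_hausdorff.
  + exact: complement_no_isolated.
- by move=> D y; exact: interior_val (hyperspace_openC A) D y.
Qed.

Lemma nQ6_complement A : A <> [set: X] :> set X ->
  nQ6 n (Y A) <->
  forall k : {ffun 'I_n.+1 -> nat}, (exists i, b (k i) `<=` A) \/
    avoided_by n (fun D => forall i, D `&` b (k i) !=set0) A.
Proof.
move=> /complement_neq0 Y0.
rewrite -(@open_tuplesP A _ id id) => //; first by split=> [[]|].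
move=> D y; split=> [[z Dz /val_inj <-]//|Dy]; by exists y.
Qed.

Lemma nQ5_complement A : A <> [set: X] :> set X ->
  nQ5 n (Y A) <->
  forall mk : {m : nat & {ffun 'I_m -> nat}},
    (exists i, b (tagged mk i) `<=` A) \/
    avoided_by n (fun D => forall i, D `&` b (tagged mk i) !=set0) A.
Proof.
move=> /complement_neq0 Y0.
have idP (D : set (Y A)) (y : Y A) : id (val @` D) (val y) <-> id D y.
  by split=> [[z Dz /val_inj <-]//|Dy]; exists y.
split=> [[_ QY] [m k] /=|mkD].
  apply: (open_tuplesP m idP).1 => U UO.
  have [|_ [i _ <-]|D CD DU] := QY (range U) _ _.
  - exact/finite_image/finite_finset.
  - exact: UO.
  - by exists D => // i; apply: DU; exists i.
split=> // UU /finite_setP[m]; rewrite card_eq_sym => /card_set_bijP[f fb] UUO.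
have := (open_tuplesP m idP).2.
move=> /(_ (fun k => mkD (existT _ m k)) (fun i => f (val i))).
have [_ _ fs] := fb; move=> [i|D CD DU].
  by apply: UUO; apply: set_bij_sub fb _ _; exists (val i) => //=.
exists D => // U /fs[i /= im <-].
exact: DU (Ordinal im).
Qed.

End complement_of_hyperpoint.

(** Any point [x0] makes [X] a pointed space, without changing its topology. *)
Lemma compact_metric_base (R : realType) (X : metricType R) (x0 : X) :
  compact [set: X] -> @second_countable X.
Proof.
move=> cX.
pose P : pseudoPMetricType R := HB.pack (Metric.sort X) X (isPointed.Build X x0).
exact: (@compact_second_countable R P cX).
Qed.

Theorem proposition3p23 (R : realType) (X : metricType R) (n : nat) :
  is_continuum [set: X]%classic -> (0 < n)%N ->
  [/\ Gdelta (CC_n n X), Gdelta (NBO_n n X), Gdelta (S_n n X) & Gdelta (NSC_n n X)].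
Proof.
move=> ctX _; have [cX _ [x0 _]] := ctX.
have [b [ob bP]] := countable_base_enum (compact_metric_base x0 cX).
have closed_sup m (k : {ffun 'I_m -> nat}) :
    closed [set A : hyperspace X | exists i, b (k i) `<=` A].
  by apply: closed_exists => i; exact: closed_hyperspace_sup.
have closed_meet m (k : {ffun 'I_m -> nat}) :
    closed [set A : hyperspace X | exists i, A `&` closure (b (k i)) !=set0].
  apply: closed_exists => i.
  by apply: closed_hyperspace_meet; exact: closed_closure.
have Gdelta_of (J : countType) (C : J -> set (hyperspace X))
    (P : J -> set X -> Prop) (S : set (hyperspace X)) (Q : hyperspace X -> Prop) :
    (forall j, closed (C j)) ->
    S = [set A : hyperspace X | A = [set: X] :> set X \/ Q A] ->
    (forall A : hyperspace X, A <> [set: X] :> set X -> Q A <->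
      forall j, C j A \/ avoided_by n (P j) A) -> Gdelta S.
  move=> cC -> QP; rewrite (_ : mkset _ = [set A : hyperspace X |
      A = [set: X] :> set X \/ forall j, C j A \/ avoided_by n (P j) A]).
    exact: Gdelta_closed_or_avoided.
  by apply/funext => A; apply/propext/full_or_congr/QP.
split.
- apply: (Gdelta_of _ _ _ _ _ _ _ (nQ1_complement n ob bP ctX)) => // k.
  exact: closed_meet.
- apply: (Gdelta_of _ _ _ _ _ _ _ (nQo_complement n ob bP ctX)) => // k.
  exact: closed_sup.
- apply: (Gdelta_of _ _ _ _ _ _ _ (nQ5_complement n ob bP)) => // k.
  exact: closed_sup.
- apply: (Gdelta_of _ _ _ _ _ _ _ (nQ6_complement n ob bP)) => // k.
  exact: closed_sup.
Qed.
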